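(* Let $\Delta^+ = \Delta^+(p,q,r)$ be a non-perfect hyperbolic ordinary triangle group. Then: (a) $\Delta^+$ has a smooth finite soluble quotient with derived length at most $3$; (b) if $c$ denotes the minimum derived length of a smooth finite soluble quotient of $\Delta^+$, then for every integer $d > c$, $\Delta^+$ has infinitely many smooth finite soluble quotients with derived length $d$. In particular, $\Delta^+$ has infinitely many smooth finite soluble quotients with derived length $d$ for every integer $d > 3$.
   Context: For integers $p,q,r\ge 2$, the ordinary triangle group is $\Delta^+(p,q,r)=\langle x,y \mid x^p=y^q=(xy)^r=1\rangle$. It is hyperbolic if $1/p+1/q+1/r<1$. A group is perfect if it equals its derived (commutator) subgroup. A quotient $G$ of $\Delta^+(p,q,r)$ (i.e. the image of a surjective homomorphism $\varphi$, equivalently $\Delta^+(p,q,r)/\ker\varphi$) is called smooth if $\varphi(x),\varphi(y),\varphi(xy)$ have orders exactly $p,q,r$ respectively; equivalently, $\ker\varphi$ is torsion-free. Distinct quotients are counted as distinct normal subgroups (kernels). The derived length of a soluble group $G$ is the least $d$ with $G^{(d)}=1$, where $G^{(0)}=G$ and $G^{(i+1)}=[G^{(i)},G^{(i)}]$. *)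

(* Defs.v *)
From HB Require Import structures.
From mathcomp Require Import all_boot all_order all_algebra all_fingroup all_solvable.
Set Implicit Arguments. Unset Strict Implicit. Unset Printing Implicit Defensive.
Import GRing.Theory Num.Theory.

Definition hyperbolic (p q r : nat) : Prop :=
  ((1 / p%:R) + (1 / q%:R) + (1 / r%:R) < (1 : rat))%R.

(* Delta^+(p,q,r) is non-perfect iff Delta^+/[Delta^+,Delta^+] is nontrivial,
   i.e. iff there is a nontrivial homomorphism from Delta^+ to an abelian group.
   A homomorphism Delta^+ -> A (A abelian, written additively) is exactly a pair
   (a, b) = (image of x, image of y) satisfying the defining relations. *)
Definition nonperfect_triangle (p q r : nat) : Prop :=
  exists (A : zmodType) (a b : A),
    [/\ (a *+ p = 0)%R, (b *+ q = 0)%R, ((a + b) *+ r = 0)%R & (a != 0)%R || (b != 0)%R].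

(* A finite quotient of Delta^+(p,q,r) is given by a finite group together with
   the images x, y of the generators; the quotient group is <<{x, y}>>. *)
Record marked := Marked { mT : finGroupType; mx : mT; my : mT }.

Definition mgroup (Q : marked) : {set mT Q} := <<[set mx Q; my Q]>>%g.

(* smooth: x, y, xy have orders exactly p, q, r (so in particular the triangle
   relations hold and the map Delta^+ -> <<x,y>> is a surjective homomorphism). *)
Definition smooth_quotient (p q r : nat) (Q : marked) : Prop :=
  [/\ #[mx Q]%g = p, #[my Q]%g = q & #[(mx Q * my Q)%g]%g = r].

Inductive letter := LX | LY | LXi | LYi.

Definition eval_letter (Q : marked) (l : letter) : mT Q :=
  match l with
  | LX => mx Q | LY => my Q | LXi => ((mx Q)^-1)%g | LYi => ((my Q)^-1)%g
  end.

Definition eval_word (Q : marked) (w : seq letter) : mT Q :=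
  foldr (fun l acc => (eval_letter Q l * acc)%g) 1%g w.

(* Two quotients have the same kernel in Delta^+ iff the same words become
   trivial in both. *)
Definition same_kernel (Q1 Q2 : marked) : Prop :=
  forall w : seq letter, (eval_word Q1 w == 1%g) = (eval_word Q2 w == 1%g).

Definition derived_length_is (gT : finGroupType) (G : {set gT}) (d : nat) : Prop :=
  (G^`(d))%g = 1%g /\ forall e, e < d -> (G^`(e))%g != 1%g.

Definition smooth_soluble (p q r : nat) (Q : marked) : Prop :=
  smooth_quotient p q r Q /\ solvable (mgroup Q).

Definition min_smooth_soluble_dlen (p q r c : nat) : Prop :=
  (exists Q, smooth_soluble p q r Q /\ derived_length_is (mgroup Q) c) /\
  (forall Q e, smooth_soluble p q r Q -> derived_length_is (mgroup Q) e -> c <= e).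

Definition infinitely_many_smooth_soluble (p q r d : nat) : Prop :=
  exists f : nat -> marked,
    (forall n, smooth_soluble p q r (f n) /\ derived_length_is (mgroup (f n)) d) /\
    (forall i j, i <> j -> ~ same_kernel (f i) (f j)).

(* Main.v *)
(* Smooth quotients are built inside wreath products W = B^G : G, always by
   conjugating the canonical copies of the generators by elements of the base
   group, so that orders are under control.

   (a) Let y lie outside <x> in G, let c be the function with value 1 in Z_n
   at the identity of G and 0 elsewhere, and let w = (xy)^c.  Then w y^-1, y, w
   have orders n #[x], #[y], #[xy].  A prime dividing two of p, q, r gives a
   cyclic quotient; one such step makes it noncyclic over <x>, a second one gives x
   its full order p.  A direct product over the three generators is smooth.

   (b) Let G be a smooth quotient with derived length d + 1 and N = G^(d), and
   let V consist of the functions G -> Z_l with sum 0 over the cosets Ng, where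
   the prime l exceeds #|G|.  Then V^N = 0, and |V^g| ^ #[g] <= |V| for g in G,
   so hyperbolicity makes |V^x| |V^y| |V^xy| < |V|.  By counting, there are
   a, b, c in V with x^a y^b = (xy)^c such that (x^a, y^b) is not a conjugate
   of (x, y) under V.  By Schur-Zassenhaus H = <x^a, y^b> meets V in some
   A != 1, and A = [A, N] is contained in H^(d + 1), so H is a smooth quotient
   with derived length d + 2.  Different l give different kernels, as l divides
   #|H| while the order of W involves only l and the primes of #|G|. *)

Require Import Defs.
From HB Require Import structures.
From mathcomp Require Import all_boot all_order all_algebra all_fingroup all_solvable.
From mathcomp Require Import ring.
Set Implicit Arguments. Unset Strict Implicit. Unset Printing Implicit Defensive.
Import GroupScope GRing.Theory.

(** * The wreath product of a finite abelian group by a finite group *)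

Section Wreath.
Variables (gT : finGroupType) (B : finZmodType).

Definition translate (g : gT) (f : {ffun gT -> B}) : {ffun gT -> B} :=
  [ffun h => f (g^-1 * h)].

Lemma translate1 f : translate 1 f = f.
Proof. by apply/ffunP=> h; rewrite ffunE invg1 mul1g. Qed.

Lemma translateM g h f : translate (g * h) f = translate g (translate h f).
Proof. by apply/ffunP=> k; rewrite !ffunE invMg mulgA. Qed.

Lemma translateD g f1 f2 :
  translate g (f1 + f2)%R = (translate g f1 + translate g f2)%R.
Proof. by apply/ffunP=> h; rewrite !ffunE. Qed.

Lemma translate0 g : translate g 0%R = 0%R.
Proof. by apply/ffunP=> h; rewrite !ffunE. Qed.

Lemma translateN g f : translate g (- f)%R = (- translate g f)%R.
Proof. by apply/ffunP=> h; rewrite !ffunE. Qed.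

Lemma translateB g f1 f2 :
  translate g (f1 - f2)%R = (translate g f1 - translate g f2)%R.
Proof. by rewrite translateD translateN. Qed.

Lemma translate_sum g (I : Type) (s : seq I) (P : pred I) (F : I -> {ffun gT -> B}) :
  translate g (\sum_(i <- s | P i) F i)%R = (\sum_(i <- s | P i) translate g (F i))%R.
Proof. exact: (big_morph _ (translateD g) (translate0 g)). Qed.

Definition wreath : Type := ({ffun gT -> B} * gT)%type.
HB.instance Definition _ := Finite.on wreath.

Definition wr_mul (u v : wreath) : wreath :=
  ((u.1 + translate u.2 v.1)%R, u.2 * v.2).
Definition wr_one : wreath := (0%R, 1).
Definition wr_inv (u : wreath) : wreath := ((- translate u.2^-1 u.1)%R, u.2^-1).

Fact wr_mulA : associative wr_mul.
Proof.
by move=> u v w; rewrite /wr_mul /= translateM translateD addrA mulgA.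
Qed.

Fact wr_mul1 : left_id wr_one wr_mul.
Proof. by case=> f g; rewrite /wr_mul /= translate1 add0r mul1g. Qed.

Fact wr_mulV : left_inverse wr_one wr_inv wr_mul.
Proof. by case=> f g; rewrite /wr_mul /= addNr mulVg. Qed.

HB.instance Definition _ := Finite_isGroup.Build wreath wr_mulA wr_mul1 wr_mulV.

Definition wr_proj (u : wreath) : gT := u.2.

Lemma wr_projM : {in [set: wreath] &, {morph wr_proj : u v / u * v}}.
Proof. by []. Qed.
Canonical wr_proj_morphism := Morphism wr_projM.

Definition wr_base (f : {ffun gT -> B}) : wreath := (f, 1).
Definition wr_lift (g : gT) : wreath := (0%R, g).


Lemma wr_mulE (u v : wreath) : u * v = ((u.1 + translate u.2 v.1)%R, u.2 * v.2).
Proof. by []. Qed.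
Lemma wr_invE (u : wreath) : u^-1 = ((- translate u.2^-1 u.1)%R, u.2^-1).
Proof. by []. Qed.

Lemma wr_baseM f1 f2 : wr_base f1 * wr_base f2 = wr_base (f1 + f2)%R.
Proof. by rewrite wr_mulE /= translate1 mul1g. Qed.

Lemma wr_liftM : {in [set: gT] &, {morph wr_lift : g h / g * h}}.
Proof. by move=> g h _ _; rewrite wr_mulE /= translate0 addr0. Qed.
Canonical wr_lift_morphism := Morphism wr_liftM.

Lemma injm_wr_lift : 'injm wr_lift.
Proof. by apply/injmP=> g h _ _ []. Qed.

(** The base part is a coboundary, so the relation [x^a * y^b = (x * y)^c] between such conjugates
    becomes a linear equation in [a], [b], [c]. *)
Lemma wr_conj_base f g :
  wr_lift g ^ wr_base f = ((translate g f - f)%R, g).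
Proof.
by rewrite conjgE wr_mulE wr_invE /= invg1 !translate1 add0r mul1g mulg1 addrC.
Qed.

Lemma wr_expE (u : wreath) k :
  u ^+ k = ((\sum_(i < k) translate (u.2 ^+ i) u.1)%R, u.2 ^+ k).
Proof.
elim: k => [|k IHk]; first by rewrite big_ord0.
by rewrite expgSr IHk wr_mulE /= big_ord_recr expgSr.
Qed.

Lemma order_wr_lift g : #[wr_lift g] = #[g].
Proof. by rewrite (order_injm injm_wr_lift) ?inE. Qed.

Lemma wr_proj_der (A : {group wreath}) k : wr_proj @* A^`(k) = (wr_proj @* A)^`(k).
Proof. by rewrite morphim_der ?subsetT. Qed.

Lemma ker_wr_projP (u : wreath) : reflect (exists f, u = wr_base f) (u \in 'ker wr_proj).
Proof.
apply: (iffP (kerP _ (in_setT _))) => [|[f ->] //].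
by case: u => f g; rewrite /wr_proj /= => ->; exists f.
Qed.

Lemma abelian_ker_wr_proj : abelian ('ker wr_proj).
Proof.
apply/centsP=> u /ker_wr_projP[f ->] v /ker_wr_projP[h ->].
by rewrite /commute !wr_baseM addrC.
Qed.

Lemma der_wreath (A : {group wreath}) k : (wr_proj @* A)^`(k) = 1 -> A^`(k.+1) = 1.
Proof.
move=> A1; have sAk : A^`(k) \subset 'ker wr_proj.
  by rewrite ker_trivg_morphim subsetT wr_proj_der A1 subxx.
by rewrite dergSn; apply/commG1P; apply: abelianS sAk abelian_ker_wr_proj.
Qed.

Lemma card_wreath : #|[set: wreath]| = (#|B| ^ #|gT| * #|gT|)%N.
Proof. by rewrite cardsT card_prod card_ffun. Qed.

End Wreath.

(** * Coprime torsion and counting by fibres *)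

Lemma mulrn_coprime_eq0 (A : zmodType) m n (c : A) :
  coprime m n -> (c *+ m = 0)%R -> (c *+ n = 0)%R -> (c = 0)%R.
Proof.
case: m => [|m] comn cm cn.
  by move: comn; rewrite /coprime gcd0n => /eqP n1; rewrite n1 in cn.
have [u v /eqP E _] := egcdnP n (ltn0Sn m).
have /(congr1 (fun i => (c *+ i)%R)) := eqP E.
by rewrite (eqP comn) mulnC mulrnA cm mul0rn mulrnDr
  mulnC mulrnA cn mul0rn add0r mulr1n => <-.
Qed.

Lemma mulrn_card (B : finZmodType) (b : B) : (b *+ #|B| = 0)%R.
Proof. by rewrite -FinRing.zmodXgE -cardsT expg_cardG ?inE. Qed.

(* A finite form of rank-nullity: [d u v] stands for the difference [u - v]. *)
Lemma leq_card_fibres (U W : finType) (phi : U -> W) (d : U -> U -> U)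
    (S K : {set U}) :
    (forall u, injective (d^~ u)) ->
    {in S &, forall u v, phi u = phi v -> d u v \in K} ->
  #|S| <= (#|phi @: S| * #|K|)%N.
Proof.
move=> inj_d dK; rewrite -sum1_card (partition_big_imset phi) -sum_nat_const /=.
apply: leq_sum => _ /imsetP[v Sv ->]; rewrite sum1dep_card -(card_imset _ (inj_d v)).
apply: subset_leq_card; apply/subsetP=> _ /imsetP[u + ->].
by rewrite inE => /andP[Su /eqP]; apply: dK.
Qed.

(** * Smooth quotients of derived length at most 3 *)

Lemma raise_order (gT : finGroupType) (x y : gT) n :
    0 < n -> y \notin <[x]> ->
  exists (hT : finGroupType) (x' y' : hT),
    [/\ #[x'] = (n * #[x])%N, #[y'] = #[y], #[x' * y'] = #[x * y]
      & forall k, [set: gT]^`(k) = 1 -> [set: hT]^`(k.+1) = 1].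
Proof.
case: n => // n _ ynx; pose B : finZmodType := 'I_n.+1.
pose del : {ffun gT -> B} := [ffun h => if h == 1 then Zp1 else 0%R].
pose w := x * y; pose y' : wreath gT B := wr_lift B y.
pose w' := wr_lift B w ^ wr_base del.
pose x' := w' * y'^-1.
have x'E : x' = ((translate w del - del)%R, x).
  by rewrite /x' /w' /y' wr_conj_base wr_mulE wr_invE /=
    translate0 oppr0 translate0 addr0 mulgK.
exists (wreath gT B), x', y'; split.
(* At the identity, the [i]-th summand of the base part evaluates [del] at the inverses of
   [x ^+ i * w] and [x ^+ i]. The first is never 1, as [y] lies outside [<[x]>]; the second is 1
   only for [i = 0]. Hence the value -1, of additive order [n]. *)
- have [f xaE f1] : exists2 f : {ffun gT -> B}, x' ^+ #[x] = wr_base f & f 1 = (- Zp1)%R.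
    exists (x' ^+ #[x]).1; rewrite wr_expE x'E /= ?expg_order //.
    have [m Em] : exists m, #[x] = m.+1 by exists #[x].-1; rewrite prednK.
    rewrite Em big_ord_recl ffunE sum_ffunE /= translate1 !ffunE big1 => [|i _].
      rewrite !mulg1 eqxx invg_eq1 addr0 ifN ?sub0r //.
      by apply: contraNneq ynx => /(canRL (mulKg x)) ->; rewrite mulg1 groupV cycle_id.
    rewrite !ffunE !mulg1 /= -invMg !invg_eq1 !ifN ?subr0 //.
      by rewrite -order_dvdn Em gtnNdvd ?ltnS /bump ?leq0n ?add1n.
    rewrite /w mulgA -expgSr; apply: contraNneq ynx => /(canRL (mulKg _)) ->.
    by rewrite mulg1 groupV mem_cycle.
  have torsion j : x' ^+ (#[x] * j) = wr_base (f *+ j)%R.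
    by rewrite expgM xaE; elim: j => // j IHj; rewrite expgS IHj wr_baseM mulrS.
  apply/eqP; rewrite eqn_dvd order_dvdn mulnC torsion; apply/andP; split.
    apply/eqP; congr (_, _); apply/ffunP=> h; rewrite ffunMnE !ffunE Zp_mulrn.
    by apply: val_inj; rewrite /= modnMl.
  have /dvdnP[j kE] : #[x] %| #[x'].
    rewrite order_dvdn; have /(congr1 snd) := expg_order x'.
    by rewrite wr_expE x'E /= => ->.
  rewrite kE mulnC dvdn_pmul2r ?order_gt0 //.
  have /(congr1 (fun u : wreath gT B => u.1 1)) := expg_order x'.
  rewrite kE mulnC torsion /= ffunMnE f1 ffunE mulNrn => /eqP.
  rewrite oppr_eq0 Zp_mulrn => /eqP/(congr1 val) /=.
  by rewrite modnMml mul1n => /eqP.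
- exact: order_wr_lift.
- by rewrite mulgKV orderJ order_wr_lift.
- move=> k Gk; apply: (@der_wreath _ _ [set: wreath gT B]%G).
  by apply/trivgP; rewrite -Gk dergS // subsetT.
Qed.

(** The derived series is that of the whole type rather than of the subgroup generated by [x] and
    [y]: this form passes directly to wreath and direct products. *)
Definition triple_realized (p q r k : nat) : Prop :=
  exists (gT : finGroupType) (x y : gT),
    [/\ #[x] = p, #[y] = q, #[x * y] = r & [set: gT]^`(k) = 1].

(** The pair [y], [(x * y)^-1] has product [x^-1]. *)
Lemma triple_rot p q r k : triple_realized p q r k -> triple_realized q r p k.
Proof.
case=> gT [x] [y] [xp yq xyr Gk]; exists gT, y, (x * y)^-1; split=> //.
  by rewrite orderV.
by rewrite invMg mulKVg orderV.
Qed.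

Lemma cyclic_quotient n : 0 < n ->
  exists (gT : finGroupType) (g : gT), #[g] = n /\ [set: gT]^`(1) = 1.
Proof.
case: n => // n _; exists 'I_n.+1, Zp1; rewrite order_Zp1; split=> //.
by rewrite derg1; apply/commG1P; apply/centsP=> a _ b _; apply: addrC.
Qed.

(* A prime dividing two of the periods gives a cyclic quotient.  If it divides
   [q] and [r], then [x] can be killed there; otherwise the generator that is
   killed gets its full order from [raise_order], and this order is not a
   divisor of the common prime order of the other two. *)
Lemma noncyclic_stage p q r :
    1 < p -> 1 < q -> 1 < r ->
    [|| ~~ coprime q r, ~~ coprime p q | ~~ coprime p r] ->
  exists (gT : finGroupType) (x y : gT),
    [/\ #[x] %| p, #[y] %| q, #[x * y] %| r, y \notin <[x]> & [set: gT]^`(2) = 1].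
Proof.
move=> p1 q1 r1 ncop.
have common m n : 1 < m -> ~~ coprime m n -> exists2 s, prime s & (s %| m) && (s %| n).
  move=> m1 ncopmn; exists (pdiv (gcdn m n)).
    by rewrite pdiv_prime // ltn_neqAle eq_sym ncopmn gcdn_gt0 ltnW.
  by rewrite -dvdn_gcd pdiv_dvd.
have [coqr | /(common _ _ q1)[s s_pr /andP[sq sr]]] := boolP (coprime q r); last first.
  have [gT [g [og G1]]] := cyclic_quotient (prime_gt0 s_pr); exists gT, 1, g.
  rewrite mul1g order1 og dvd1n sq sr cycle1 inE -order_eq1 og.
  split=> //; first by rewrite gtn_eqF ?prime_gt1.
  by apply/trivgP; rewrite -G1 der_subS.
rewrite coqr /= in ncop.
have raise1 s n : prime s -> 0 < n -> exists (hT : finGroupType) (x y : hT),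
    [/\ #[x] = n, #[y] = s, #[x * y] = s & [set: hT]^`(2) = 1].
  move=> s_pr n0; have [gT [g [og G1]]] := cyclic_quotient (prime_gt0 s_pr).
  have [|hT [x [y [ox oy oxy Hk]]]] := @raise_order gT 1 g n n0.
    by rewrite cycle1 inE -order_eq1 og gtn_eqF ?prime_gt1.
  exists hT, x, y; rewrite ox oy oxy mul1g og order1 muln1; split=> //.
  exact: Hk.
have cyc_dvd s n (hT : finGroupType) (x y : hT) :
    prime s -> 1 < n -> #[x] = n -> #[y] = s -> x \in <[y]> -> n = s.
  move=> s_pr n1 ox oy /order_dvdG; rewrite -/#[y] ox oy.
  by case/primeP: s_pr => _ /(_ n) div /div /pred2P[n_1|//]; rewrite n_1 in n1.
have notboth s : prime s -> s %| q -> s %| r -> False.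
  move=> s_pr sq sr; have: s %| gcdn q r by rewrite dvdn_gcd sq.
  by rewrite (eqP coqr) dvdn1 gtn_eqF ?prime_gt1.
case/orP: ncop => /(common _ _ p1)[s s_pr /andP[sp s2]].
  have [hT [x [y [ox oy oxy Hk]]]] := raise1 s r s_pr (ltnW r1).
  (* The raised element [x], of order [r], becomes the product up to inversion. *)
  exists hT, y, (x * y)^-1; rewrite invMg mulKVg !orderV -invMg orderV oy oxy ox; split=> //.
  rewrite groupV groupMr ?cycle_id //; apply/negP=> xy.
  by apply: (notboth s) => //; rewrite (cyc_dvd _ _ _ _ _ s_pr r1 ox oy xy).
have [hT [x [y [ox oy oxy Hk]]]] := raise1 s q s_pr (ltnW q1).
exists hT, y, x; rewrite ox oy; split=> //.
  by rewrite -(orderJ (y * x) y) conjgE -mulgA mulKg oxy.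
apply/negP=> xy.
by apply: (notboth s) => //; rewrite (cyc_dvd _ _ _ _ _ s_pr q1 ox oy xy).
Qed.

(** The previous stage has derived length at most 2 and [y] outside [<[x]>], so one more wreath
    product multiplies [#[x]] by [p %/ #[x]] and costs one derived step. *)
Lemma exact_first p q r :
    1 < p -> 1 < q -> 1 < r ->
    [|| ~~ coprime q r, ~~ coprime p q | ~~ coprime p r] ->
  exists q' r', [/\ q' %| q, r' %| r & triple_realized p q' r' 3].
Proof.
move=> p1 q1 r1 ncop.
have [gT [x [y [xp yq xyr ynx G2]]]] := noncyclic_stage p1 q1 r1 ncop.
have [|hT [x' [y' [ox' oy' oxy' Hk]]]] := raise_order (n := p %/ #[x]) _ ynx.
  by rewrite divn_gt0 // dvdn_leq // ltnW.
exists #[y], #[x * y]; split=> //; exists hT, x', y'; split=> //; last exact: Hk.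
by rewrite ox' divnK.
Qed.

Lemma triple_prod p q r p' q' r' k :
    triple_realized p q r k -> triple_realized p' q' r' k ->
  triple_realized (lcmn p p') (lcmn q q') (lcmn r r') k.
Proof.
have order_pair (gT hT : finGroupType) (g : gT) (h : hT) :
    #[(g, h) : gT * hT] = lcmn #[g] #[h].
  apply/eqP; rewrite eqn_dvd dvdn_lcm order_dvdn.
  have expE n : ((g, h) : gT * hT) ^+ n = (g ^+ n, h ^+ n).
    by elim: n => // n IHn; rewrite !expgS IHn.
  rewrite expE -[1]/(1, 1) xpair_eqE -!order_dvdn dvdn_lcml dvdn_lcmr /=.
  rewrite !order_dvdn; have := expg_order ((g, h) : gT * hT).
  by rewrite expE => -[-> ->]; rewrite !eqxx.
case=> gT [x [y [<- <- <- Gk]]] [hT [x' [y' [<- <- <- Hk]]]].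
exists (gT * hT)%type, (x, x'), (y, y'); rewrite -!order_pair; split=> //.
apply/trivgP/subsetP=> -[g h] gh; rewrite inE -[1]/(1, 1) xpair_eqE.
have: g \in fst @* [set: gT * hT]^`(k) by apply: (mem_morphim _ _ gh); rewrite inE.
have: h \in snd @* [set: gT * hT]^`(k) by apply: (mem_morphim _ _ gh); rewrite inE.
rewrite !morphim_der ?subsetT //.
move/(subsetP (dergS k (subsetT _))); rewrite Hk => /set1P->.
by move/(subsetP (dergS k (subsetT _))); rewrite Gk => /set1P->; rewrite !eqxx.
Qed.

(** Each rotation of [exact_first] is exact in one period and gives divisors of the other two.
    Orders in a direct product are lcms, so the product of the three is exact everywhere. *)
Lemma triple_realized3 p q r :
    1 < p -> 1 < q -> 1 < r ->
    [|| ~~ coprime q r, ~~ coprime p q | ~~ coprime p r] ->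
  triple_realized p q r 3.
Proof.
move=> p1 q1 r1 ncop.
have [q2 [r2 [q2q r2r T1]]] := exact_first p1 q1 r1 ncop.
have [|r3 [p3 [r3r p3p T2]]] := exact_first q1 r1 p1.
  by move: ncop; rewrite (coprime_sym r p) (coprime_sym q p); do 3!case: (coprime _ _).
have [|p4 [q4 [p4p q4q T3]]] := exact_first r1 p1 q1.
  by move: ncop; rewrite (coprime_sym r p) (coprime_sym r q); do 3!case: (coprime _ _).
have := triple_prod T1 (triple_prod (triple_rot (triple_rot T2)) (triple_rot T3)).
have lcmE a b c : b %| a -> c %| a -> lcmn a (lcmn b c) = a.
  by move=> ba ca; apply/lcmn_idPl; rewrite dvdn_lcm ba.
by rewrite lcmE // (lcmnCA q2) lcmE // (lcmnC r3) (lcmnCA r2) lcmE.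
Qed.

(** For pairwise coprime periods, [a = (a + b) - b] is killed by both [p] and [q * r], hence is 0;
    then [b] is killed by both [q] and [r]. *)
Lemma nonperfect_common p q r : nonperfect_triangle p q r ->
  [|| ~~ coprime q r, ~~ coprime p q | ~~ coprime p r].
Proof.
case=> A [a [b [ap bq abr /orP ab]]].
rewrite -!negb_and; apply/negP=> /and3P[coqr copq copr].
have a0 : a = 0%R.
  apply: (@mulrn_coprime_eq0 _ p (q * r)%N) => //; first by rewrite coprimeMr copq.
  have -> : a = (a + b - b)%R by rewrite addrK.
  by rewrite mulrnBl mulnC mulrnA abr mul0rn mulnC mulrnA bq mul0rn subrr.
have b0 : b = 0%R.
  by apply: (@mulrn_coprime_eq0 _ q r) => //; rewrite a0 add0r in abr.
by case: ab => /eqP.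
Qed.

(** * Invariant functions, functions of norm zero, and nonsplit conjugates *)

Section InvariantFunctions.
Variables (gT : finGroupType) (B : finZmodType).
Local Notation W := {ffun gT -> B}.
Implicit Types (H N : {group gT}) (f : W).

Definition invariants (H : {set gT}) : {set W} :=
  [set f | [forall h in H, translate h f == f]].

Lemma invariantsP (H : {set gT}) f :
  reflect {in H, forall h, translate h f = f} (f \in invariants H).
Proof. by rewrite inE; apply: eqfun_inP. Qed.

(** Invariance under [H] means being constant on right cosets of [H]. Functions on cosets are
    encoded as functions on all subsets that vanish off the cosets. *)
Lemma card_invariants H : #|invariants H| = (#|B| ^ #|[set: gT] : H|)%N.
Proof.
pose D := rcosets H [set: gT].
pose lift (F : {ffun {set gT} -> B}) : W := [ffun g => F (H :* g)].
have inD g : H :* g \in D by rewrite -rcosetE imset_f ?inE.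
pose S := [set F : {ffun {set gT} -> B} | F \in pffun_on 0%R (mem D) (mem [set: B])].
have S0 F A : F \in S -> A \notin D -> F A = 0%R.
  rewrite inE => /pffun_onP[/subsetP suppF _] DA; apply/eqP.
  by apply: contraNT DA => FA; apply: suppF.
have -> : invariants H = lift @: S.
  apply/setP=> f; apply/invariantsP/imsetP=> [Hf | [F _ ->] h Hh]; last first.
    by apply/ffunP=> g; rewrite !ffunE rcosetM rcoset_id ?groupV.
  exists [ffun A : {set gT} => if A \in D then f (repr A) else 0%R].
    rewrite inE; apply/pffun_onP; split=> [|b _]; last by rewrite inE.
    by apply/subsetP=> A; rewrite inE ffunE; case: ifP => //; rewrite eqxx.
  apply/ffunP=> g; rewrite !ffunE inD; have /rcosetP[h Hh ->] := mem_repr_rcoset H g.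
  by rewrite -{1}(Hf h^-1) ?groupV // ffunE invgK.
rewrite card_in_imset => [|F1 F2 SF1 SF2 /ffunP eqF].
  by rewrite cardsE card_pffun_on cardsT.
apply/ffunP=> A; have [/imsetP[g _ ->]|DA] := boolP (A \in D); last by rewrite !S0.
by have := eqF g; rewrite !ffunE rcosetE.
Qed.

(** The value at [h] is the sum of [f] over the coset [N :* h], so [norm_ker N] is the module V of
    functions with zero coset sums. *)
Definition norm_sum (N : {set gT}) f : W := (\sum_(z in N) translate z f)%R.
Definition norm_ker (N : {set gT}) : {set W} := [set f | norm_sum N f == 0%R].

Lemma norm_kerD (N : {set gT}) f1 f2 :
  f1 \in norm_ker N -> f2 \in norm_ker N -> (f1 + f2)%R \in norm_ker N.
Proof.
rewrite !inE /norm_sum => /eqP f1N /eqP f2N.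
under eq_bigr do rewrite translateD.
by rewrite big_split /= f1N f2N addr0.
Qed.

Lemma norm_kerN (N : {set gT}) f : f \in norm_ker N -> (- f)%R \in norm_ker N.
Proof.
rewrite !inE /norm_sum => /eqP fN.
under eq_bigr do rewrite translateN.
by rewrite sumrN fN oppr0.
Qed.

Lemma norm_kerB (N : {set gT}) f1 f2 :
  f1 \in norm_ker N -> f2 \in norm_ker N -> (f1 - f2)%R \in norm_ker N.
Proof. by move=> f1N f2N; rewrite norm_kerD ?norm_kerN. Qed.

Lemma norm_ker0 (N : {set gT}) : 0%R \in norm_ker N.
Proof. by rewrite inE /norm_sum big1 // => z _; apply: translate0. Qed.

Lemma norm_ker_translate N g f :
  g \in 'N(N) -> f \in norm_ker N -> translate g f \in norm_ker N.
Proof.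
move=> nNg; rewrite !inE /norm_sum => /eqP fN; apply/eqP.
rewrite (reindex_inj (conjg_inj g^-1)) /=.
rewrite (eq_bigl (mem N)) => [|z]; last by rewrite /= memJ_norm ?groupV.
under eq_bigr => z _ do rewrite -translateM conjgE invgK -mulgA mulgKV translateM.
by rewrite -translate_sum fN translate0.
Qed.

Lemma norm_sum_invariant N f : norm_sum N f \in invariants N.
Proof.
apply/invariantsP=> g Ng; rewrite /norm_sum translate_sum.
rewrite [RHS](reindex_inj (mulgI g)) /=; apply: eq_big => [z|z _].
  by rewrite groupMl.
by rewrite translateM.
Qed.

Hypothesis coB : coprime #|B| #|gT|.

(** On functions invariant under [N] the norm is multiplication by [#|N|], which is injective
    because [#|B|] is coprime to [#|N|]. *)
Lemma norm_ker_invariant_eq0 N f :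
  f \in norm_ker N -> f \in invariants N -> f = 0%R.
Proof.
rewrite inE => /eqP fN /invariantsP Nf.
have fNn : (f *+ #|N| = 0)%R.
  by rewrite -fN /norm_sum (eq_bigr (fun=> f)) ?sumr_const // => z /Nf.
apply/ffunP=> g; rewrite ffunE; apply: (@mulrn_coprime_eq0 _ #|B| #|N|).
- by apply: coprime_dvdr coB; rewrite -cardsT cardSg ?subsetT.
- exact: mulrn_card.
- by rewrite -ffunMnE fNn ffunE.
Qed.

(** Rank-nullity for [norm_sum N], whose image consists of invariants of [N]. *)
Lemma card_norm_ker N : (#|B| ^ #|gT| <= #|norm_ker N| * #|invariants N|)%N.
Proof.
rewrite -card_ffun -cardsT mulnC.
apply: (leq_trans (@leq_card_fibres _ _ (norm_sum N) (fun u v => u - v)%R _ (norm_ker N) _ _)).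
- by move=> u; apply: addIr.
- move=> u v _ _ uv; rewrite inE /norm_sum; apply/eqP.
  under eq_bigr do rewrite translateB.
  by rewrite sumrB; apply/eqP; rewrite subr_eq0; apply/eqP.
- apply: leq_mul => //; apply: subset_leq_card.
  by apply/subsetP=> _ /imsetP[f _ ->]; apply: norm_sum_invariant.
Qed.

(** The invariants of [<[x]>] contain the direct sum of [Vx] and the invariants of [N <*> <[x]>].
    Raise the resulting inequality to the power [#[x]], use that [N] has index at most [#[x]] in [N
    <*> <[x]>], and cancel the number of invariants of [N] against [card_norm_ker]. *)
Lemma card_norm_ker_invariants N x : x \in 'N(N) ->
  (#|norm_ker N :&: invariants <[x]>| ^ #[x] <= #|norm_ker N|)%N.
Proof.
move=> nNx; set V := norm_ker N; set Vx := V :&: _.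
have B_gt0 : 0 < #|B| by apply/card_gt0P; exists 0%R.
have splitx : (#|Vx| * #|invariants (N <*> <[x]>)| <= #|invariants <[x]>|)%N.
  rewrite -cardsX -(card_in_imset (f := fun vw : W * W => (vw.1 + vw.2)%R)).
    apply: subset_leq_card; apply/subsetP=> _ /imsetP[[v w] /setXP[/= vVx wN] ->].
    case/setIP: vVx => _ /invariantsP vx; apply/invariantsP=> h xh.
    by rewrite translateD vx // (invariantsP _ _ wN) // mem_gen // inE xh orbT.
  move=> [v w] [v' w'] /setXP[/= /setIP[vV _] wN] /setXP[/= /setIP[vV' _] wN'] E.
  have vv : (v - v' = w' - w)%R.
    by apply/eqP; rewrite subr_eq addrAC eq_sym subr_eq E addrC.
  have vv0 : (v - v' = 0)%R.
    apply: (@norm_ker_invariant_eq0 N); first by rewrite norm_kerB.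
    rewrite vv; apply/invariantsP=> h Nh; rewrite translateB.
    by rewrite (invariantsP _ _ wN) ?(invariantsP _ _ wN') // mem_gen // inE Nh.
  by congr (_, _); apply/eqP; rewrite -subr_eq0 ?vv0 // -oppr_eq0 opprB -vv vv0.
have idx : (#|[set: gT] : N| <= #|[set: gT] : N <*> <[x]>| * #[x])%N.
  rewrite -(Lagrange_index (subsetT (N <*> <[x]>)) (joing_subl _ _)) leq_mul2l.
  apply/orP; right; rewrite -(leq_pmul2l (cardG_gt0 N)) Lagrange ?joing_subl //.
  by rewrite /= norm_joinEr ?cycle_subG // orderE mul_cardG leq_pmulr // cardG_gt0.
have := card_norm_ker N; rewrite -/V => cV.
have BN_gt0 : (0 < #|B| ^ #|[set: gT] : N|)%N by rewrite expn_gt0 B_gt0.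
rewrite -(leq_pmul2r BN_gt0).
rewrite card_invariants in cV; apply: leq_trans cV.
rewrite !card_invariants in splitx.
apply: (@leq_trans ((#|Vx| ^ #[x] * #|B| ^ (#|[set: gT] : N <*> <[x]>| * #[x]))%N)).
  by rewrite leq_mul2l leq_pexp2l ?orbT.
rewrite expnM -expnMn.
apply: leq_trans (_ : ((#|B| ^ #|[set: gT] : <[x]>|) ^ #[x] <= _)%N).
  by rewrite leq_exp2r.
by rewrite -expnM mulnC Lagrange ?subsetT // cardsT.
Qed.

(* The space of solutions [(a, b, c)] of [x^a y^b = (xy)^c] in the norm kernel
   has at least [|V|^2] elements, of which at most [|V| |V^x| |V^y| |V^xy|] come
   from conjugating [(x, y, xy)] by a single element of [V]. *)
Lemma nonsplit_conjugates N x y :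
    x \in 'N(N) -> y \in 'N(N) -> N :!=: 1 -> 1 < #|B| ->
    (#[y] * #[x * y] + #[x] * #[x * y] + #[x] * #[y] < #[x] * #[y] * #[x * y])%N ->
  exists a b c : W,
    [/\ [/\ a \in norm_ker N, b \in norm_ker N & c \in norm_ker N],
        wr_lift B x ^ wr_base a * wr_lift B y ^ wr_base b
          = wr_lift B (x * y) ^ wr_base c
      & forall t, t \in norm_ker N ->
          wr_lift B x ^ wr_base t = wr_lift B x ^ wr_base a ->
          wr_lift B y ^ wr_base t <> wr_lift B y ^ wr_base b].
Proof.
move=> nNx nNy ntN B_gt1 hyp; set w := x * y in hyp *.
have nNw : w \in 'N(N) by rewrite groupM.
set V := norm_ker N; pose Fx g := V :&: invariants <[g]>.
have V_gt1 : 1 < #|V|.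
  have BN_gt0 : (0 < #|B| ^ #|[set: gT] : N|)%N by rewrite expn_gt0 (ltnW B_gt1).
  rewrite -(ltn_pmul2r BN_gt0) mul1n -card_invariants; apply: leq_trans (card_norm_ker N).
  rewrite card_invariants ltn_exp2l // -divgS ?subsetT // -cardsT.
  by rewrite ltn_Pdiv ?cardG_gt0 // cardG_gt1.
have few : (#|Fx x| * #|Fx y| * #|Fx w| < #|V|)%N.
  (* After raising to this power, the three fixed-point bounds have the common base [#|V|], and
     [hyp] compares the exponents. *)
  have o_gt0 : (0 < #[x] * #[y] * #[w])%N by rewrite !muln_gt0 !order_gt0.
  rewrite -(ltn_exp2r _ _ o_gt0) !expnMn.
  apply: leq_ltn_trans (_ : #|V| ^ (#[y] * #[w] + #[x] * #[w] + #[x] * #[y]) < _)%N; last first.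
    by rewrite ltn_exp2l.
  rewrite !expnD; apply: leq_mul; first apply: leq_mul.
  - by rewrite -mulnA expnM leq_exp2r ?muln_gt0 ?order_gt0 // card_norm_ker_invariants.
  - by rewrite -mulnA mulnCA expnM leq_exp2r ?muln_gt0 ?order_gt0 // card_norm_ker_invariants.
  - by rewrite mulnC expnM leq_exp2r ?muln_gt0 ?order_gt0 // card_norm_ker_invariants.
(* [phi] measures the failure of the relation in the base. [S] is the set of its solutions, and [T]
   contains those obtained from one [t] by adding fixed vectors. *)
pose phi (u : W * W * W) : W :=
  ((translate x u.1.1 - u.1.1) + translate x (translate y u.1.2 - u.1.2)
   - (translate w u.2 - u.2))%R.
pose VVV := setX (setX V V) V.
pose S := [set u in VVV | phi u == 0%R].
pose T := (fun u : W * (W * W * W) => ((u.1 + u.2.1.1, u.1 + u.2.1.2), u.1 + u.2.2)%R)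
  @: setX V (setX (setX (Fx x) (Fx y)) (Fx w)).
have Vtr g f : g \in 'N(N) -> f \in V -> (translate g f - f)%R \in V.
  by move=> nNg Vf; rewrite norm_kerB ?norm_ker_translate.
have many : (#|V| * #|V| <= #|S|)%N.
  rewrite -(leq_pmul2r (ltnW V_gt1)).
  have -> : (#|V| * #|V| * #|V|)%N = #|VVV| by rewrite !cardsX.
  have inj_d (u : W * W * W) :
      injective ((fun v u => ((v.1.1 - u.1.1, v.1.2 - u.1.2), v.2 - u.2)%R)^~ u).
    by move=> [[a b] c] [[a' b'] c'] [/addIr-> /addIr-> /addIr->].
  apply: leq_trans (leq_card_fibres (phi := phi) (S := VVV) (K := S) inj_d _) _.
    move=> [[a b] c] [[a' b'] c'] /setXP[/= /setXP[/= Va Vb] Vc].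
    move=> /setXP[/= /setXP[/= Va' Vb'] Vc'] E.
    have subrACA (f1 f2 f3 f4 : W) : ((f1 - f2) - (f3 - f4) = (f1 - f3) - (f2 - f4))%R.
      by rewrite !opprD addrACA.
    have deltaB g (f h : W) :
        (translate g (f - h) - (f - h) = (translate g f - f) - (translate g h - h))%R.
      by rewrite translateB subrACA.
    rewrite inE; apply/andP; split.
      by apply/setXP; split=> /=; [apply/setXP; split|]; apply: norm_kerB.
    rewrite /phi /= !deltaB (translateB x (translate y b - b)%R) addrACA -opprD.
    rewrite (subrACA _ _ (translate w c - c)%R).
    by rewrite subr_eq0; apply/eqP.
  rewrite mulnC leq_mul2l; apply/orP; right; apply: subset_leq_card.
  apply/subsetP=> _ /imsetP[[[a b] c] /setXP[/= /setXP[/= Va Vb] Vc] ->].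
  apply: norm_kerB (Vtr w c nNw Vc); apply: norm_kerD (Vtr x a nNx Va) _.
  exact: norm_ker_translate nNx (Vtr y b nNy Vb).
have : ~~ (S \subset T).
  apply/negP=> /subset_leq_card; apply/negP; rewrite -ltnNge.
  apply: leq_trans many; apply: leq_ltn_trans (leq_imset_card _ _) _.
  by rewrite !cardsX ltn_pmul2l ?(ltnW V_gt1).
case/subsetPn=> -[[a b] c]; rewrite inE => /andP[/setXP[/= /setXP[/= Va Vb] Vc] /eqP phi0] notT.
exists a, b, c; split=> // [|t Vt].
  rewrite !wr_conj_base wr_mulE /=; congr (_, _).
  by apply/eqP; rewrite -subr_eq0; apply/eqP.
rewrite !wr_conj_base => -[xt] [yt]; case/negP: notT.
(* Conjugation by [t] is multiplicative, so agreement on [x] and [y] forces agreement on [w]; the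
   triple then lies in [T]. *)
have wt : (translate w t - t = translate w c - c)%R.
  apply/eqP; rewrite eq_sym -subr_eq0 -oppr_eq0 opprB -phi0 /phi /= -xt -yt.
  apply/eqP; congr (_ - _)%R; rewrite translateB -translateM.
  by rewrite [RHS]addrC addrA addrNK.
have inFx g f : f \in V -> (translate g t - t = translate g f - f)%R -> (f - t)%R \in Fx g.
  move=> Vf E; rewrite inE norm_kerB //=; apply/invariantsP=> h /cycleP[k ->].
  have fixg : (translate g (f - t) = f - t)%R.
    by apply/eqP; rewrite translateB subr_eq -addrA (addrC (- t)%R) E addrC addrNK.
  by elim: k => [|k IHk]; rewrite ?translate1 // expgS translateM IHk.
apply/imsetP; exists (t, ((a - t, b - t), c - t))%R.
  by rewrite !in_setX /= Vt !inFx.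
by rewrite /= ![(t + _)%R]addrC !addrNK.
Qed.

End InvariantFunctions.

(** * Raising the derived length by one *)

Section Extension.
Variables (gT : finGroupType) (B : finZmodType).

Lemma wr_base_conj f (u : wreath gT B) :
  wr_base f ^ u = wr_base (translate u.2^-1 f).
Proof.
rewrite conjgE /wr_base !wr_mulE wr_invE /= mul1g mulVg translate1 translateD.
by rewrite addrC addrK.
Qed.

Lemma wr_base_inv (f : {ffun gT -> B}) : (wr_base f)^-1 = wr_base (- f)%R.
Proof. by rewrite wr_invE /= invg1 translate1. Qed.

Lemma card_ker_wr_proj : #|'ker (@wr_proj gT B)| = (#|B| ^ #|gT|)%N.
Proof.
have -> : 'ker (@wr_proj gT B) = (@wr_base gT B) @: setT.
  apply/setP=> u; apply/ker_wr_projP/imsetP=> [[f ->]|[f _ ->]]; first by exists f.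
  by exists f.
by rewrite card_imset ?cardsT ?card_ffun // => f1 f2 [].
Qed.

Variable V : {set {ffun gT -> B}}.
Hypotheses (V0 : 0%R \in V)
  (VD : forall f1 f2, f1 \in V -> f2 \in V -> (f1 + f2)%R \in V).

Definition wr_sub : {set wreath gT B} := (@wr_base gT B) @: V.

Lemma wr_sub_group_set : group_set wr_sub.
Proof.
apply/group_setP; split=> [|_ _ /imsetP[f1 Vf1 ->] /imsetP[f2 Vf2 ->]].
  by apply/imsetP; exists 0%R.
by rewrite wr_baseM imset_f ?VD.
Qed.
Definition wr_sub_group := Group wr_sub_group_set.

End Extension.

Lemma der_subset_leq (gT : finGroupType) (G : {group gT}) i d :
  i <= d -> G^`(d) \subset G^`(i).
Proof.
move/subnK <-; elim: (d - i)%N => // k IHk.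
exact: subset_trans (der_subS _ _) IHk.
Qed.

Lemma extend_derived_length (gT : finGroupType) (B : finZmodType) (x y : gT) d :
    prime #|B| -> coprime #|B| #|gT| ->
    (#[y] * #[x * y] + #[x] * #[x * y] + #[x] * #[y] < #[x] * #[y] * #[x * y])%N ->
    <<[set x; y]>>^`(d) != 1 -> <<[set x; y]>>^`(d.+1) = 1 ->
  exists uv : wreath gT B * wreath gT B,
    [/\ #[uv.1] = #[x], #[uv.2] = #[y] & #[uv.1 * uv.2] = #[x * y]]
    /\ [/\ <<[set uv.1; uv.2]>>^`(d.+1) != 1, <<[set uv.1; uv.2]>>^`(d.+2) = 1
         & #|B| %| #|<<[set uv.1; uv.2]>>|].
Proof.
move=> B_pr coB hyp; set G := <<[set x; y]>> => ntN G1.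
pose N := (G^`(d))%G.
have nNG : G \subset 'N(N) by apply: der_norm.
have Gx : x \in G by rewrite mem_gen ?set21.
have Gy : y \in G by rewrite mem_gen ?set22.
have [a [b [c [[Va Vb _] rel nonsplit]]]] := nonsplit_conjugates coB
  (subsetP nNG x Gx) (subsetP nNG y Gy) ntN (prime_gt1 B_pr) hyp.
set x' := _ ^ wr_base a in rel *; set y' := _ ^ wr_base b in rel *.
exists (x', y') => /=; set H := <<[set x'; y']>>.
split; first by rewrite rel !orderJ !order_wr_lift.
pose V := wr_sub_group (norm_ker0 B N) (@norm_kerD gT B N).
pose G0 := (wr_lift B @* G)%G; pose N0 := (wr_lift B @* N)%G.
have VP f : (wr_base f \in V) = (f \in norm_ker B N).
  by apply/imsetP/idP=> [[f' Vf' [->]]|Vf] //; exists f.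
have sVK : V \subset 'ker (@wr_proj gT B).
  by apply/subsetP=> _ /imsetP[f _ ->]; apply/ker_wr_projP; exists f.
have abV : abelian V by apply: abelianS sVK (abelian_ker_wr_proj _ _).
have nVG0 : G0 \subset 'N(V).
  apply/subsetP=> _ /morphimP[g _ Gg ->]; rewrite inE.
  apply/subsetP=> _ /imsetP[_ /imsetP[f Vf ->] ->].
  by rewrite wr_base_conj VP norm_ker_translate //= groupV (subsetP nNG).
have G0x : wr_lift B x \in G0 by apply: mem_morphim; rewrite ?inE.
have G0y : wr_lift B y \in G0 by apply: mem_morphim; rewrite ?inE.
have sVG0 : V <*> G0 = V * G0 by apply: norm_joinEr.
have sHVG0 : H \subset V * G0.
  rewrite -sVG0 gen_subG; apply/subsetP=> u /set2P[] ->.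
    by rewrite groupJ ?mem_gen // inE ?G0x ?orbT // VP Va.
  by rewrite groupJ ?mem_gen // inE ?G0y ?orbT // VP Vb.
have projH : @wr_proj gT B @* H = G.
  rewrite morphim_gen ?subsetT // morphimEsub ?subsetT // imsetU1 imset_set1.
  by rewrite /x' /y' !wr_conj_base.
have HV u : u \in H -> exists2 v, v \in V & u = v * wr_lift B (wr_proj u).
  move/(subsetP sHVG0)=> /mulsgP[_ _ /imsetP[f Vf ->] /morphimP[g _ _ ->] ->].
  by exists (wr_base f); rewrite ?VP // /wr_proj /= mul1g.
pose A := (H :&: V)%G.
have AP u : u \in H -> wr_proj u = 1 -> u \in A.
  move=> Hu u1; have [v Vv] := HV u Hu.
  by rewrite u1 (morph1 (wr_lift_morphism gT B)) mulg1 inE Hu => ->.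
have coVG0 : coprime #|V| #|G0|.
  rewrite card_injm ?injm_wr_lift ?subsetT //.
  apply: coprime_dvdl (cardSg sVK) _; rewrite card_ker_wr_proj coprimeXl //.
  by apply: coprime_dvdr coB; rewrite -cardsT cardSg ?subsetT.
(* If [A] were trivial, [H] would have the order of [G0], so [H] would be [G0] conjugated by some
   [t] in [V]. As the projection is injective on [H], this same [t] would give both [x'] and [y'],
   against [nonsplit]. *)
have ntA : A :!=: 1.
  apply/eqP=> A1; have injH : {in H &, injective (@wr_proj gT B)}.
    move=> u v Hu Hv uv; have: u * v^-1 \in A.
      apply: AP; first by rewrite groupM ?groupV.
      by rewrite -(mulgV (wr_proj v)) -{1}uv.
    by rewrite A1 => /set1P/(canRL (mulgKV v)); rewrite mul1g.
  have cardH : #|H| = #|G0|.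
    have -> : #|G0| = #|G| by rewrite card_injm ?injm_wr_lift ?subsetT.
    by rewrite -projH morphimEsub ?subsetT // card_in_imset.
  have [_ /imsetP[t Vt ->] HG0] :=
    SchurZassenhaus_trans_sol (abelian_sol abV) nVG0 sHVG0 coVG0 cardH.
  apply: (nonsplit t Vt); apply: injH.
  - by rewrite [H]HG0 memJ_conjg.
  - by rewrite mem_gen ?set21.
  - by rewrite !wr_conj_base.
  - by rewrite [H]HG0 memJ_conjg.
  - by rewrite mem_gen ?set22.
  - by rewrite !wr_conj_base.
(* As [f] has norm [0], its multiple [#|N| f] is the sum of the [f - z f]. *)
have AN0 : A \subset [~: A, N0].
  apply/subsetP=> u Au; case/setIP: (Au) => _ /imsetP[f Vf uE].
  have uN : u ^+ #|N| \in [~: A, N0].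
    have -> : u ^+ #|N| = wr_base (\sum_(z in N) (f - translate z f))%R.
      rewrite sumrB -/(norm_sum N f); move: Vf; rewrite inE => /eqP ->.
      rewrite subr0 sumr_const uE; elim: #|N| => // k IHk.
      by rewrite expgS IHk wr_baseM mulrS.
    elim/big_ind: _ => [|f1 f2|z Nz]; first exact: group1.
      by rewrite -wr_baseM; apply: groupM.
    have -> : wr_base (f - translate z f)%R = [~ u, wr_lift B z^-1]^-1.
      rewrite commgEl uE wr_base_conj /= invgK invMg invgK wr_base_inv wr_baseM.
      by rewrite addrC.
    by rewrite groupV mem_commg // mem_morphim ?inE ?groupV.
  (* The order of [u] divides [#|V|], hence is coprime to [#|N|], so [u] is a power of
     [u ^+ #|N|]. *)
  have gen_u : generator <[u]> (u ^+ #|N|).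
    rewrite generator_coprime; have /setIP[_ Vu] := Au.
    apply: coprime_dvdl (order_dvdG Vu) (coprime_dvdr _ coVG0).
    by rewrite card_injm ?injm_wr_lift ?subsetT // cardSg ?der_sub.
  have : u \in <[u]> by apply: cycle_id.
  by rewrite (eqP gen_u); apply/subsetP; rewrite cycle_subG.
have AH i : i <= d.+1 -> A \subset H^`(i).
  elim: i => [|i IHi] id; first exact: subsetIl.
  apply: subset_trans AN0 _; rewrite gen_subG.
  apply/subsetP=> _ /imset2P[u _ Au /morphimP[z _ Nz ->] ->].
  have : z \in @wr_proj gT B @* H^`(i).
    by rewrite wr_proj_der projH (subsetP (der_subset_leq _ (id : i <= d))).
  case/morphimP=> h _ Hh hz; have [v Vv hE] := HV h (subsetP (der_sub _ _) _ Hh).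
  have -> : [~ u, wr_lift B z] = [~ u, h].
    have /commgP/eqP uv : commute u v by apply: (centsP abV) => //; case/setIP: Au.
    by rewrite hE -hz commgMJ uv conj1g mulg1.
  by apply: mem_commg => //; apply: (subsetP (IHi (ltnW id))).
have Hd2 : H^`(d.+2) = 1 by apply: der_wreath; rewrite projH.
split=> //.
  by apply: contra ntA => /eqP H1; rewrite -subG1 -H1 AH.
apply: dvdn_trans (cardSg (subsetIl H V)).
have pA : (#|B|).-nat #|A|.
  apply: pnat_dvd (cardSg (subset_trans (subsetIr H V) sVK)) _.
  by rewrite card_ker_wr_proj pnatX pnat_id.
by case/p_natP: pA => [] // [|k] E; rewrite E ?dvdn_exp //; move: ntA; rewrite -cardG_gt1 E.
Qed.

(** * Words, kernels and infinite families of quotients *)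

Lemma eval_word_cat (Q : marked) w1 w2 :
  eval_word Q (w1 ++ w2) = eval_word Q w1 * eval_word Q w2.
Proof. by elim: w1 => [|l w1 IH] /=; rewrite ?mul1g // IH mulgA. Qed.

Lemma mgroup_eval_word (Q : marked) g :
  g \in mgroup Q -> exists w, eval_word Q w = g.
Proof.
case/gen_prodgP=> n [c Ac ->]; elim: n c Ac => [|n IHn] c Ac.
  by exists [::]; rewrite big_ord0.
have [w Ew] := IHn _ (fun i => Ac (lift ord0 i)).
have /set2P[Ec|Ec] := Ac ord0; [exists (LX :: w) | exists (LY :: w)];
  by rewrite big_ord_recl Ec /= Ew.
Qed.

(** The powers of [w] are again words, so the kernel determines the order of the image of [w]. *)
Lemma same_kernel_order (Q1 Q2 : marked) w :
  same_kernel Q1 Q2 -> #[eval_word Q1 w] = #[eval_word Q2 w].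
Proof.
move=> sk; pose pw k := flatten (nseq k w).
have powE Q k : eval_word Q (pw k) = eval_word Q w ^+ k.
  by elim: k => // k IHk; rewrite /pw /= eval_word_cat IHk expgS.
by apply/eqP; rewrite eqn_dvd !order_dvdn -!powE sk powE expg_order eqxx
  -sk powE expg_order eqxx.
Qed.

Lemma hyperbolic_nat p q r : 0 < p -> 0 < q -> 0 < r -> hyperbolic p q r ->
  (q * r + p * r + p * q < p * q * r)%N.
Proof.
move=> p0 q0 r0; rewrite /hyperbolic => hyp.
have nz n : 0 < n -> (n%:R != 0 :> rat)%R by rewrite Num.Theory.pnatr_eq0 -lt0n.
rewrite -(Num.Theory.ltr_nat rat) !natrD !natrM.
have pqr0 : (0 < p%:R * q%:R * r%:R :> rat)%R.
  by rewrite !Num.Theory.mulr_gt0 ?Num.Theory.ltr0n.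
have := Num.Theory.ltr_pM2l pqr0 (1 / p%:R + 1 / q%:R + 1 / r%:R)%R 1%R.
rewrite hyp mulr1 => /idP; congr (_ < _)%O.
by field; rewrite !nz.
Qed.

Lemma derived_length_step p q r (Q : marked) d :
    2 <= p -> 2 <= q -> 2 <= r -> hyperbolic p q r ->
    smooth_soluble p q r Q -> derived_length_is (mgroup Q) d ->
  infinitely_many_smooth_soluble p q r d.+1.
Proof.
move=> p2 q2 r2 /hyperbolic_nat hyp [[op oq or] solQ] [Gd ntG].
(* Derived length 0 would make [mx Q] trivial, while its order is [p >= 2]. *)
case: d Gd ntG => [|d] Gd ntG.
  have: mx Q \in mgroup Q by rewrite mem_gen ?set21.
  by rewrite -[mgroup Q]derg0 Gd => /set1P x1; rewrite -op x1 order1 in p2.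
(* A strictly increasing sequence of primes above [#|mT Q|], one for each quotient of the family. *)
pose l := fix l n := if n is k.+1 then s2val (prime_above (l k))
  else s2val (prime_above #|mT Q|).
have l_pr n : prime (l n).
  case: n => [|n]; first exact: (s2valP' (prime_above #|mT Q|)).
  exact: (s2valP' (prime_above (l n))).
have l_ltS n : l n < l n.+1 by apply: (s2valP (prime_above (l n))).
have l_mono : {homo l : i j / i < j} by apply: homo_ltn => // ? ? ?; apply: ltn_trans.
have l_big n : #|mT Q| < l n.
  elim: n => [|n IHn]; first exact: (s2valP (prime_above #|mT Q|)).
  exact: ltn_trans (l_ltS n).
pose B n : finZmodType := 'I_(l n).-1.+1.
have cardB n : #|B n| = l n by rewrite card_ord prednK ?prime_gt0.
have coB n : coprime #|B n| #|mT Q|.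
  rewrite cardB prime_coprime ?l_pr // gtnNdvd //.
  by rewrite -cardsT cardG_gt0.
pose P n (uv : wreath (mT Q) (B n) * wreath (mT Q) (B n)) :=
  [&& [&& #[uv.1] == p, #[uv.2] == q & #[uv.1 * uv.2] == r],
      <<[set uv.1; uv.2]>>^`(d.+1) != 1, <<[set uv.1; uv.2]>>^`(d.+2) == 1
    & l n %| #|<<[set uv.1; uv.2]>>|].
have exP n : exists uv, P n uv.
  have [||||uv [[ou ov ouv] [H1 H2 Hl]]] :=
    @extend_derived_length (mT Q) (B n) (mx Q) (my Q) d _ (coB n).
  - by rewrite cardB.
  - by rewrite op oq or hyp // ltnW.
  - exact: ntG.
  - exact: Gd.
  by exists uv; rewrite /P ou ov ouv op oq or !eqxx H1 H2 eqxx -cardB.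
pose f n := Marked (xchoose (exP n)).1 (xchoose (exP n)).2.
exists f; split=> [n | i j ij sk].
  have /and4P[/and3P[/eqP ox /eqP oy /eqP oxy] H1 /eqP H2 _] := xchooseP (exP n).
  split; last first.
    split=> // e; rewrite ltnS => le_ed; apply: contra H1 => /eqP He.
    by rewrite -subG1 -He der_subset_leq.
  by split=> //; apply/derivedP; exists d.+2; rewrite H2.
(* Quotient [i] has an element of order [l i]. With equal kernels the same word has order [l i] in
   quotient [j], whose ambient wreath product has order a power of [l j] times [#|mT Q|]; so
   [l i = l j]. *)
have /and4P[_ _ _ li] := xchooseP (exP i).
have [g Hg og] := Cauchy (l_pr i) li.
have [w wE] := @mgroup_eval_word (f i) g Hg.
have := same_kernel_order w sk; rewrite wE og => lE.
have : l i %| #|[set: wreath (mT Q) (B j)]| by rewrite lE order_dvdG ?inE.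
rewrite card_wreath cardB Euclid_dvdM ?l_pr // Euclid_dvdX ?l_pr //.
case/orP=> [/andP[]|]; last by rewrite gtnNdvd // -cardsT cardG_gt0.
rewrite dvdn_prime2 ?l_pr // => /eqP lij _.
by have [/l_mono|/l_mono|//] := ltngtP i j; rewrite lij ltnn.
Qed.

(** Induction on [d]: one member of the family of derived length [d] is the start for [d.+1]. *)
Lemma infinitely_many_above p q r (Q : marked) c d :
    2 <= p -> 2 <= q -> 2 <= r -> hyperbolic p q r ->
    smooth_soluble p q r Q -> derived_length_is (mgroup Q) c -> c < d ->
  infinitely_many_smooth_soluble p q r d.
Proof.
move=> p2 q2 r2 hyp smQ Qc; elim: d => // d IHd.
rewrite ltnS leq_eqVlt => /predU1P[<-|/IHd[f [fP _]]].
  exact: derived_length_step smQ Qc.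
by have [smf fd] := fP 0; apply: derived_length_step smf fd.
Qed.

Theorem theorem1p1 (p q r : nat) :
  2 <= p -> 2 <= q -> 2 <= r ->
  hyperbolic p q r ->
  nonperfect_triangle p q r ->
  [/\ (exists Q, smooth_soluble p q r Q /\
                 exists d, d <= 3 /\ derived_length_is (mgroup Q) d),
      (forall c, min_smooth_soluble_dlen p q r c ->
         forall d, c < d -> infinitely_many_smooth_soluble p q r d)
    & (forall d, 3 < d -> infinitely_many_smooth_soluble p q r d)].
Proof.
move=> p2 q2 r2 hyp /nonperfect_common ncop.
have partA : exists Q, smooth_soluble p q r Q /\
    exists d, d <= 3 /\ derived_length_is (mgroup Q) d.
  have [gT [x [y [ox oy oxy G3]]]] := triple_realized3 p2 q2 r2 ncop.
  pose Q := Marked x y; exists Q.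
  have Q3 : (mgroup Q)^`(3) = 1.
    by apply/trivgP; rewrite -G3; apply: dergS (subsetT _).
  split; first by split=> //; apply/derivedP; exists 3; rewrite Q3.
  (* The exact derived length is the least exponent at which the series vanishes. *)
  have exd : exists d, (mgroup Q)^`(d) == 1 by exists 3; rewrite Q3.
  case: (ex_minnP exd) => d /eqP Qd min_d; exists d; split.
    by apply: min_d; rewrite Q3.
  by split=> // e; rewrite ltnNge; apply: contra; apply: min_d.
split=> // [c [[Q [smQ Qc]] _] d | d d3].
  exact: infinitely_many_above smQ Qc.
have [Q [smQ [c [c3 Qc]]]] := partA.
exact: infinitely_many_above smQ Qc (leq_ltn_trans c3 d3).
Qed.
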